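(* Let $\mathcal{K}=(K,M^b(K),\circ,* )$ be a finite hypergroup. If the $*$-structure of $\mathcal{K}$ is trivial, i.e. $c^*=c$ for all $c\in K$, then $\mathcal{K}$ is commutative.
   Context: For a finite set $K=\{c_0,c_1,\dots,c_n\}$ (distinct elements), let $M^b(K)=\{\sum_{j=0}^n a_j\delta_{c_j}: a_j\in\mathbb{C}\}$ be the complex measures on $K$ and $M^1(K)=\{\sum_j a_j\delta_{c_j}: a_j\ge 0,\ \sum_j a_j=1\}$ the probability measures, where $\delta_c$ is the Dirac measure at $c$. The support of $\mu=\sum_j a_j\delta_{c_j}$ is $\mathrm{supp}(\mu)=\{c_j: a_j\neq 0\}$. A finite hypergroup $\mathcal{K}=(K,M^b(K),\circ,* )$ is a finite set $K=\{c_0,\dots,c_n\}$ together with a product $\circ$ (convolution) and an involution $*$ on $M^b(K)$ such that: (a) $(M^b(K),\circ,* )$ is an associative $*$-algebra with unit $\delta_{c_0}$; (b) $\delta_{c_i}\circ\delta_{c_j}\in M^1(K)$ for all $c_i,c_j\in K$; (c) there is an involutive bijection $c_i\mapsto c_i^*$ of $K$ with $\delta_{c_i^*}=\delta_{c_i}^*$, and for all $c_i,c_j\in K$ one has $c_j=c_i^*$ if and only if $c_0\in\mathrm{supp}(\delta_{c_i}\circ\delta_{c_j})$. $\mathcal{K}$ is commutative if $\circ$ is commutative on $M^b(K)$. *)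

(* Defs.v *)
From mathcomp Require Import all_boot all_order all_algebra.
From mathcomp Require Import complex reals.

Set Implicit Arguments.
Unset Strict Implicit.
Unset Printing Implicit Defensive.

Import Order.TTheory GRing.Theory Num.Theory.
Local Open Scope ring_scope.
Local Open Scope complex_scope.

(* The complex measure \sum_c a_c delta_c on the finite set K is encoded by its
   weight function c |-> a_c; R[i] is the field of complex numbers.  The [^o]
   makes the scalars of the vector space R[i] rather than R. *)
Definition measures (R : realType) (K : finType) := {ffun K -> R[i]^o}.

Definition dirac (R : realType) (K : finType) (c : K) : measures R K :=
  [ffun x => (x == c)%:R].

Definition supp (R : realType) (K : finType) (mu : measures R K) : {set K} :=
  [set c | mu c != 0].

(* In R[i], [0 <= z] means that z is real and nonnegative. *)
Definition is_probability (R : realType) (K : finType) (mu : measures R K) :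
    Prop :=
  (forall c, 0 <= mu c) /\ \sum_c mu c = 1.

Record is_star_algebra (R : realType) (V : lmodType R[i])
    (mul : V -> V -> V) (one : V) (star : V -> V) : Prop := IsStarAlgebra {
  star_algebra_linearr : forall x, linear (mul x);
  star_algebra_linearl : forall y, linear (mul^~ y);
  star_algebra_mulA : associative mul;
  star_algebra_mul1x : left_id one mul;
  star_algebra_mulx1 : right_id one mul;
  star_algebra_star_antilinear : forall (a : R[i]) x y,
    star (a *: x + y) = Num.conj a *: star x + star y;
  star_algebra_starK : involutive star;
  star_algebra_starM : forall x y, star (mul x y) = mul (star y) (star x) }.

Record hypergroup (R : realType) (K : finType) := Hypergroup {
  hyp_unit : K;
  conv : measures R K -> measures R K -> measures R K;
  mstar : measures R K -> measures R K;
  cstar : K -> K;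
  hyp_star_algebra : is_star_algebra conv (dirac R hyp_unit) mstar;
  hyp_probability : forall ci cj : K,
    is_probability (conv (dirac R ci) (dirac R cj));
  hyp_cstarK : involutive cstar;
  hyp_cstarE : forall c : K, dirac R (cstar c) = mstar (dirac R c);
  hyp_supp : forall ci cj : K,
    cj = cstar ci <-> hyp_unit \in supp (conv (dirac R ci) (dirac R cj)) }.

Definition trivial_star (R : realType) (K : finType) (H : hypergroup R K) :
    Prop :=
  forall c : K, cstar H c = c.

Definition is_commutative (R : realType) (K : finType) (H : hypergroup R K) :
    Prop :=
  commutative (conv H).

(* Main.v *)
(* Every product delta_c o delta_d has real weights and every delta_c is fixed
   by the involution, so the antilinear involution fixes delta_c o delta_d.
   Being an antimorphism, it also maps it to delta_d o delta_c; commutativity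
   then extends from the Dirac measures by bilinearity. *)
Require Import Defs.
From mathcomp Require Import all_boot all_order all_algebra.
From mathcomp Require Import complex reals.

Set Implicit Arguments.
Unset Strict Implicit.
Unset Printing Implicit Defensive.

Import Order.TTheory GRing.Theory Num.Theory.
Local Open Scope ring_scope.
Local Open Scope complex_scope.

Lemma measure_sum_dirac (R : realType) (K : finType) (mu : measures R K) :
  mu = \sum_c (mu c : R[i]) *: dirac R c.
Proof.
apply/ffunP => x; rewrite sum_ffunE (bigD1 x) //= big1 => [|c neq_cx].
  (* Scaling in [R[i]^o] is multiplication by conversion, so [mulr1] applies to [*:]. *)
  by rewrite !ffunE eqxx addr0 [_ *: _]mulr1.
by rewrite !ffunE eq_sym (negbTE neq_cx) [_ *: _]mulr0.
Qed.

(* The twist [s] is [id] for linear maps and conjugation for antilinear ones. *)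
Lemma semilinear_sum_dirac (R : realType) (K : finType) (V : lmodType R[i])
    (s : R[i] -> R[i]) (f : measures R K -> V) :
  s 1 = 1 -> (forall (a : R[i]) x y, f (a *: x + y) = s a *: f x + f y) ->
  forall mu : measures R K, f mu = \sum_c s (mu c) *: f (dirac R c).
Proof.
move=> s1 fP mu.
have f0 : f 0 = 0.
  (* Since [s 1 = 1], this instance reads [f 0 = f 0 + f 0]. *)
  have := fP 1 0 0; rewrite scaler0 addr0 s1 scale1r => /eqP.
  by rewrite -subr_eq subrr eq_sym => /eqP.
rewrite {1}[mu]measure_sum_dirac.
elim: (index_enum K) => [|c r IHr]; first by rewrite !big_nil.
by rewrite !big_cons fP IHr.
Qed.

Lemma linear_eq_dirac (R : realType) (K : finType) (V : lmodType R[i])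
    (f g : measures R K -> V) :
  linear f -> linear g -> (forall c, f (dirac R c) = g (dirac R c)) ->
  f =1 g.
Proof.
move=> fL gL fg mu.
rewrite (semilinear_sum_dirac (s := id) _ fL) //.
rewrite (semilinear_sum_dirac (s := id) _ gL) //.
by apply: eq_bigr => c _; rewrite fg.
Qed.

(** As each [dirac R c] is fixed, antilinearity makes [mstar] act by conjugating the weights. *)
Lemma mstar_real (R : realType) (K : finType) (H : hypergroup R K)
    (mu : measures R K) :
  trivial_star H -> (forall c, (mu c : R[i]) \is Num.real) ->
  mstar H mu = mu.
Proof.
move=> trivH mu_real; have A := hyp_star_algebra H.
rewrite (semilinear_sum_dirac (s := Num.conj) (rmorph1 _)
  (star_algebra_star_antilinear A)).
rewrite [RHS]measure_sum_dirac; apply: eq_bigr => c _.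
by rewrite -hyp_cstarE trivH (CrealP (mu_real c)).
Qed.

Lemma conv_diracC (R : realType) (K : finType) (H : hypergroup R K) (c d : K) :
  trivial_star H ->
  conv H (dirac R c) (dirac R d) = conv H (dirac R d) (dirac R c).
Proof.
move=> trivH; have [conv_ge0 _] := hyp_probability H c d.
(* Applying [mstar] to the left side changes nothing, but lets the antimorphism law swap the
   factors. *)
rewrite -[LHS](mstar_real trivH); last by move=> x; exact/ger0_real/conv_ge0.
by rewrite (star_algebra_starM (hyp_star_algebra H)) -!hyp_cstarE !trivH.
Qed.

Theorem proposition3p1 (R : realType) (K : finType) (H : hypergroup R K) :
  trivial_star H -> is_commutative H.
Proof.
move=> trivH mu nu; have A := hyp_star_algebra H.
have linr := star_algebra_linearr A; have linl := star_algebra_linearl A.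
(* Both sides are linear in [nu] for fixed [mu]; once [nu] is a Dirac measure, the same argument
   reduces [mu]. *)
apply: (linear_eq_dirac (linr mu) (linl mu)) => d.
apply: (linear_eq_dirac (linl _) (linr _)) => c.
exact: conv_diracC.
Qed.
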